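(* For every positive integer $n$, $\eta_{n+1}=A(n,3)$.
   Context: For $m\geq 2$, $f\colon\mathbb F_2^m\to\mathbb F_2$ and $i\in\{1,\ldots,m\}$, let $L_i\colon\mathbb F_2^m\to\mathbb F_2^m$ be $L_i(x_1,\ldots,x_m)=(x_1,\ldots,x_{i-1},f(x_1,\ldots,x_m),x_{i+1},\ldots,x_m)$. With $\mathrm{id}=12\cdots m$ the identity permutation, the SDS map is $F=[K_m,f,\mathrm{id}]=L_m\circ L_{m-1}\circ\cdots\circ L_1$ (the sequential dynamical system on the complete graph $K_m$ in which every vertex has vertex function $f$, updated in order $v_1,\dots,v_m$). The phase space $\Gamma(F)$ is the directed graph on vertex set $\mathbb F_2^m$ with an edge $\vec x\to F(\vec x)$ for each $\vec x$; a $2$-cycle is a set $\{\vec x,F(\vec x)\}$ with $F(\vec x)\neq\vec x$ and $F(F(\vec x))=\vec x$. $\eta_m$ denotes the maximum, over all functions $f\colon\mathbb F_2^m\to\mathbb F_2$, of the number of $2$-cycles of $\Gamma([K_m,f,\mathrm{id}])$. $A(n,3)$ denotes the maximum number of codewords in a binary code $C\subseteq\mathbb F_2^n$ with minimum Hamming distance at least $3$ (any two distinct codewords differ in at least $3$ coordinates; a code with a single codeword counts as having minimum distance $\infty$). *)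

(* Defs.v *)
From mathcomp Require Import all_boot all_order all_algebra.

Set Implicit Arguments.
Unset Strict Implicit.
Unset Printing Implicit Defensive.

Section SDS.
Variable m : nat.
Implicit Types (f : 'rV['F_2]_m -> 'F_2) (x : 'rV['F_2]_m).

Definition local_map f (i : 'I_m) x : 'rV['F_2]_m :=
  \row_j (if j == i then f x else x ord0 j).

(* [K_m, f, id] = L_m \o ... \o L_1: since [enum 'I_m] is increasing, the left
   fold applies the local map of the first vertex first. *)
Definition sds_map f x : 'rV['F_2]_m :=
  foldl (fun y i => local_map f i y) x (enum 'I_m).

End SDS.

(* A 2-cycle is an unordered pair, so {x, F x} and {F x, F (F x)} are counted
   once. *)
Definition two_cycles (T : finType) (F : T -> T) : {set {set T}} :=
  [set [set x; F x] | x : T & (F x != x) && (F (F x) == x)].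

Definition eta (m : nat) : nat :=
  \max_(f : {ffun 'rV['F_2]_m -> 'F_2}) #|two_cycles (sds_map f)|.

Definition hamming_dist (n : nat) (x y : 'rV['F_2]_n) : nat :=
  #|[set i | x ord0 i != y ord0 i]|.

(* Codes with at most one word satisfy this for every d. *)
Definition min_dist_geq (n d : nat) (C : {set 'rV['F_2]_n}) : bool :=
  [forall x in C, forall y in C, (x != y) ==> (d <= hamming_dist x y)].

Definition max_code_size (n d : nat) : nat :=
  \max_(C : {set 'rV['F_2]_n} | min_dist_geq d C) #|C|.

(* Main.v *)
Require Import Defs.
From mathcomp Require Import all_boot all_order all_algebra.

(* The two points of a 2-cycle are complementary: x and compl x.  Such a pair
   prescribes f on the states [half_compl] obtained from x, or from compl x, by
   complementing an initial segment of coordinates.  Encode the pair by the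
   vector of differences x_k + x_(k+1) in F_2^n, which determines x up to
   complement.  States of two distinct pairs coincide exactly when, up to
   complement, the two points differ on an interval, that is, when their
   difference vectors are at distance 1 or 2.  In that case exchanging the two
   points gives a second common state, and the two prescriptions of f cannot
   both be met.  Hence a set of pairs is realised by a common f iff its
   difference vectors form a code of minimum distance at least 3. *)

Set Implicit Arguments.
Unset Strict Implicit.
Unset Printing Implicit Defensive.

Import GRing.Theory.

(** * Arithmetic in F_2 *)

Section F2.
Local Open Scope ring_scope.

Lemma F2P (a : 'F_2) : a = 0 \/ a = 1.
Proof. by case: a => [[|[|k]] hk]; [left; exact: val_inj | right; exact: val_inj |]. Qed.

Lemma addFF2 (a : 'F_2) : a + a = 0.
Proof. by case: (F2P a) => ->; apply/eqP. Qed.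

Lemma addKF2 (a : 'F_2) : cancel (+%R a) (+%R a).
Proof. by move=> b; rewrite addrA addFF2 add0r. Qed.

Lemma add1_neqF2 (a : 'F_2) : 1 + a <> a.
Proof. by case: (F2P a) => ->. Qed.

Lemma neq_add1F2 (a b : 'F_2) : a != b -> b = 1 + a.
Proof. by case: (F2P a) => ->; case: (F2P b) => -> // _; apply/eqP. Qed.

Lemma addFF2_eq0 (a b : 'F_2) : (a + b == 0) = (a == b).
Proof. by case: (F2P a) => ->; case: (F2P b) => ->. Qed.

Lemma natr_negb (b : bool) : (~~ b)%:R = 1 + b%:R :> 'F_2.
Proof. by case: b; apply/eqP. Qed.

Lemma addrv_F2 m (x : 'rV['F_2]_m) : x + x = 0.
Proof. by apply/rowP => k; rewrite !mxE addFF2. Qed.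

End F2.

(** * Updating the vertices one at a time *)

Section Sweep.
Local Open Scope ring_scope.
Variables (m : nat) (f : 'rV['F_2]_m -> 'F_2).
Implicit Types x y : 'rV['F_2]_m.

(** When a sweep takes [x] to [y], this is the state after [k] updates. *)
Definition hybrid x y (k : nat) : 'rV['F_2]_m :=
  \row_j (if (j < k)%N then y ord0 j else x ord0 j).

Lemma hybrid0 x y : hybrid x y 0 = x.
Proof. by apply/rowP => j; rewrite mxE ltn0. Qed.

Lemma hybrid_full x y : hybrid x y m = y.
Proof. by apply/rowP => j; rewrite mxE ltn_ord. Qed.

Lemma hybridS x y (i : 'I_m) :
  x ord0 i = y ord0 i -> hybrid x y i.+1 = hybrid x y i.
Proof.
move=> exy; apply/rowP => j; rewrite !mxE ltnS leq_eqVlt.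
by case: eqP => [/val_inj -> | _] //=; rewrite ltnn exy.
Qed.

Definition partial_sds x (k : nat) : 'rV['F_2]_m :=
  foldl (fun y i => local_map f i y) x (take k (enum 'I_m)).

Lemma partial_sdsS x (i : 'I_m) :
  partial_sds x i.+1 = local_map f i (partial_sds x i).
Proof.
rewrite /partial_sds (take_nth i) ?size_enum_ord // nth_ord_enum.
by rewrite foldl_rcons.
Qed.

Lemma partial_sds_full x : partial_sds x m = sds_map f x.
Proof. by rewrite /partial_sds take_oversize // size_enum_ord. Qed.

Lemma partial_sdsE x (k : nat) (j : 'I_m) : (k <= m)%N ->
  partial_sds x k ord0 j = if (j < k)%N then f (partial_sds x j) else x ord0 j.
Proof.
elim: k => [|k IHk] le_km; first by rewrite /partial_sds take0.
rewrite (partial_sdsS x (Ordinal le_km)) mxE -val_eqE /= ltnS leq_eqVlt.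
by case: eqP => [-> | _] //=; rewrite IHk // ltnW.
Qed.

(** Each vertex is updated only once, so the state before each update is determined by [x] and [y];
    the recursion becomes a list of conditions on single values of [f]. *)
Lemma sds_mapP x y :
  sds_map f x = y <-> forall i : 'I_m, f (hybrid x y i) = y ord0 i.
Proof.
split=> [<- i | eqf].
  have eqh : hybrid x (sds_map f x) i = partial_sds x i.
    apply/rowP => j; rewrite mxE -partial_sds_full !partial_sdsE ?ltn_ord //.
    exact: ltnW.
  by rewrite eqh -partial_sds_full partial_sdsE ?ltn_ord.
suff eqh k : (k <= m)%N -> partial_sds x k = hybrid x y k.
  by rewrite -partial_sds_full eqh // hybrid_full.
elim: k => [|k IHk] le_km; first by rewrite hybrid0 /partial_sds take0.
rewrite (partial_sdsS x (Ordinal le_km)) (IHk (ltnW le_km)).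
apply/rowP => j; rewrite !mxE -val_eqE /= [in RHS]ltnS [in RHS]leq_eqVlt.
case: eqP => [ejk | _] /=; last by [].
by rewrite -eqf ejk.
Qed.

End Sweep.

(** * Two-cycles and complementary points *)

Section Cycles.
Local Open Scope ring_scope.
Variables (n : nat).
Implicit Types (f : 'rV['F_2]_n.+1 -> 'F_2) (x y : 'rV['F_2]_n.+1).
Implicit Types (u : 'rV['F_2]_n).

Definition compl x : 'rV['F_2]_n.+1 := const_mx 1 + x.

Lemma complK : involutive compl.
Proof. by move=> x; rewrite /compl addrA addrv_F2 add0r. Qed.

Lemma compl_neq x : compl x != x.
Proof.
by apply/eqP => /rowP/(_ ord0); rewrite !mxE; apply: add1_neqF2.
Qed.

(* If x and y agree at a vertex, then two consecutive states in the cyclic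
   sequence of 2(n+1) partial updates coincide, so x and y agree at the next
   vertex, and eventually everywhere. *)
Lemma two_cycle_compl f x : sds_map f x != x -> sds_map f (sds_map f x) = x ->
  sds_map f x = compl x.
Proof.
move Ey : (sds_map f x) => y neq_yx /sds_mapP fy.
move/sds_mapP: Ey => fx.
have next (i j : 'I_n.+1) :
    x ord0 i = y ord0 i -> j = i.+1 :> nat -> x ord0 j = y ord0 j.
  move=> exy eji; rewrite -fx -fy eji (hybridS exy).
  by rewrite hybridS // fx fy.
have up (i j : 'I_n.+1) :
    x ord0 i = y ord0 i -> (i <= j)%N -> x ord0 j = y ord0 j.
  case: j => j; elim: j => [|j IHj] hj exy; rewrite leq_eqVlt.
    rewrite ltn0 orbF => /eqP e0.
    by rewrite -(_ : i = Ordinal hj) //; apply: val_inj.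
  case/orP=> [/eqP e0 | lt_ij].
    by rewrite -(_ : i = Ordinal hj) //; apply: val_inj.
  by apply: (next (Ordinal (ltnW hj))) => //; apply: IHj.
apply/rowP => i; rewrite !mxE; apply: neq_add1F2; apply/eqP => exy.
have exyn : x ord0 ord_max = y ord0 ord_max by apply: up exy _; rewrite -ltnS.
(* Passing from the last vertex to the first: [f y] is both the last entry of [y] and the first
   entry of [x]; likewise with [x] and [y] exchanged. *)
have exy0 : x ord0 ord0 = y ord0 ord0.
  have := fy ord0; rewrite hybrid0 => <-.
  have := fx ord_max; rewrite -(hybridS exyn) hybrid_full => ->.
  rewrite -exyn.
  have := fy ord_max; rewrite -(hybridS (esym exyn)) hybrid_full => <-.
  by have := fx ord0; rewrite hybrid0 => <-.
by case/eqP: neq_yx; apply/rowP => j; rewrite (up ord0).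
Qed.

Definition half_compl x (k : nat) := hybrid x (compl x) k.

Lemma half_complE x (k : nat) j :
  half_compl x k ord0 j = (j < k)%N%:R + x ord0 j.
Proof. by rewrite !mxE; case: ifP => _; rewrite ?mxE ?add0r. Qed.

Lemma sds_map_complP f x : sds_map f x = compl x <->
  forall i : 'I_n.+1, f (half_compl x i) = 1 + x ord0 i.
Proof.
split=> [/sds_mapP H i | H]; first by rewrite /half_compl H !mxE.
by apply/sds_mapP => i; rewrite -/(half_compl x i) H !mxE.
Qed.

(** * Difference vectors *)

Definition diffs x : 'rV['F_2]_n :=
  \row_k (x ord0 (widen_ord (leqnSn n) k) + x ord0 (lift ord0 k)).

(** Section of [diffs] with first entry 0: it picks one point of each complementary pair. *)
Definition sums u : 'rV['F_2]_n.+1 := \row_k \sum_(d < n | (d < k)%N) u ord0 d.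

Lemma diffsD x y : diffs (x + y) = diffs x + diffs y.
Proof. by apply/rowP => k; rewrite !mxE addrACA. Qed.

Lemma diffs_const a : diffs (const_mx a) = 0.
Proof. by apply/rowP => k; rewrite !mxE addFF2. Qed.

Lemma diffs_compl x : diffs (compl x) = diffs x.
Proof. by rewrite diffsD diffs_const add0r. Qed.

Lemma sums_lift u (k : 'I_n) :
  sums u ord0 (lift ord0 k) = u ord0 k + sums u ord0 (widen_ord (leqnSn n) k).
Proof.
rewrite !mxE (bigD1 k) /=; last by rewrite /bump leq0n.
congr (_ + _); apply: eq_bigl => d.
by rewrite /bump leq0n add1n ltnS leq_eqVlt -val_eqE /=; case: ltngtP.
Qed.

Lemma sums0 : sums 0 = 0.
Proof. by apply/rowP => k; rewrite !mxE big1 // => d _; rewrite mxE. Qed.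

Lemma sumsK : cancel sums diffs.
Proof.
by move=> u; apply/rowP => k; rewrite mxE sums_lift addrCA addFF2 addr0.
Qed.

(** The sum of consecutive differences telescopes. *)
Lemma diffsK x : sums (diffs x) = const_mx (x ord0 ord0) + x.
Proof.
apply/rowP => -[k hk]; elim: k hk => [|k IHk] hk.
  rewrite !mxE big_pred0 // (_ : Ordinal hk = ord0) ?addFF2 //.
  exact: val_inj.
have hk' : (k < n)%N by [].
have -> : Ordinal hk = lift ord0 (Ordinal hk') by apply: val_inj.
rewrite sums_lift.
have -> : widen_ord (leqnSn n) (Ordinal hk') = Ordinal (ltnW hk) by apply: val_inj.
rewrite IHk !mxE.
have -> : widen_ord (leqnSn n) (Ordinal hk') = Ordinal (ltnW hk) by apply: val_inj.
by rewrite [X in _ + X]addrC addrA [X in X + _]addrAC addFF2 add0r addrC.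
Qed.

(** The kernel of [diffs] consists of the two constant vectors. *)
Lemma diffs_inj x y : diffs x = diffs y -> y = x \/ y = compl x.
Proof.
move=> eqd; have := diffsK (y + x).
rewrite diffsD eqd addrv_F2 sums0 => /rowP e.
have {}e k : y ord0 k = (y + x) ord0 ord0 + x ord0 k.
  have := e k; rewrite !mxE => /esym/eqP; rewrite addrA addFF2_eq0 => /eqP <-.
  by rewrite addKF2.
case: (F2P ((y + x) ord0 ord0)) e => -> e; [left | right];
  by apply/rowP => k; rewrite e ?add0r // !mxE.
Qed.

(** * Coinciding states and Hamming distance *)

Lemma half_compl_eq x y (i j : 'I_n.+1) : (i <= j)%N ->
  half_compl x i = half_compl y j <->
  forall k : 'I_n.+1, y ord0 k = ((i <= k) && (k < j))%N%:R + x ord0 k.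
Proof.
move=> le_ij; split=> [/rowP e k | e].
  have := e k; rewrite !half_complE.
  case: (ltnP k i) => [lt_ki | le_ik] /=.
    by rewrite (leq_trans lt_ki le_ij) add0r => /addrI.
  by case: ltnP => _ /=; rewrite !add0r // => ->; rewrite addKF2.
apply/rowP => k; rewrite !half_complE e.
case: (ltnP k i) => [lt_ki | le_ik] /=.
  by rewrite (leq_trans lt_ki le_ij) add0r.
by case: ltnP => _ /=; rewrite !add0r // addKF2.
Qed.

Lemma hamming_dist_diffs x y : hamming_dist (diffs x) (diffs y) =
  #|[set k | diffs (x + y) ord0 k != 0]|.
Proof.
by apply: eq_card => k; rewrite !inE diffsD !mxE addFF2_eq0.
Qed.

Lemma hamming_dist_half_compl x y (i j : 'I_n.+1) : (i < j)%N ->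
  half_compl x i = half_compl y j ->
  diffs x != diffs y /\ (hamming_dist (diffs x) (diffs y) <= 2)%N.
Proof.
move=> lt_ij /half_compl_eq e; have {}e := e (ltnW lt_ij).
split.
  (* The interval contains [i] but not [j], so [x + y] is not constant. *)
  apply/eqP => /diffs_inj[] E.
    have := e i; rewrite E leqnn lt_ij => /esym; exact: add1_neqF2.
  have := e j; rewrite E ltnn andbF mxE mxE add0r; exact: add1_neqF2.
(* [diffs] detects only the ends of the interval: shifted by one, each nonzero position of
   [diffs (x + y)] is [i] or [j]. *)
rewrite hamming_dist_diffs -(card_imset _ (@lift_inj _ ord0)).
apply: (@leq_trans #|[set i; j]|); last by rewrite cards2; case: eqP.
apply/subset_leq_card/subsetP => _ /imsetP[k + ->].
rewrite !inE !mxE !e !(addrCA (x _ _)) !addFF2 !addr0 addFF2_eq0.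
apply: contraR; rewrite negb_or -!val_eqE lift0 => /andP[ni nj].
have -> : (i <= k.+1)%N = (i <= k)%N.
  by rewrite leq_eqVlt eq_sym (negPf ni) ltnS.
have -> : (k.+1 < j)%N = (k < j)%N.
  by rewrite [RHS]leq_eqVlt (negPf nj).
exact: eqxx.
Qed.

(** One or two differences bound an interval, outside of which [x + y] is a constant; if this
    constant is 1, passing to [compl y] absorbs it. *)
Lemma hamming_dist_diffs_le2 x y :
  diffs x != diffs y -> (hamming_dist (diffs x) (diffs y) <= 2)%N ->
  exists y' (i j : 'I_n.+1),
    [/\ y' = y \/ y' = compl y, (i < j)%N & half_compl x i = half_compl y' j].
Proof.
move=> neq_d; rewrite hamming_dist_diffs.
set D := [set k | _] => cardD.
have [i [j [c [lt_ij e]]]] : exists (i j : 'I_n.+1) c, (i < j)%N /\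
   forall k : 'I_n.+1, y ord0 k = c + (((i <= k) && (k < j))%N%:R + x ord0 k).
  pose s := (x + y) ord0 ord0.
  have e c (k : 'I_n.+1) : \sum_(d < n | (d < k)%N) diffs (x + y) ord0 d = c ->
      y ord0 k = s + (c + x ord0 k).
    move=> <-; have /rowP/(_ k) := diffsK (x + y); rewrite mxE => ->.
    by rewrite -/s !mxE -[s + _ + _]addrA addKF2 addrAC addFF2 add0r.
  have sumD (k : 'I_n.+1) : \sum_(d < n | (d < k)%N) diffs (x + y) ord0 d =
      \sum_(d in D) (d < k)%N%:R.
    rewrite big_mkcond [RHS]big_mkcond; apply: eq_bigr => d _.
    by rewrite inE; case: (F2P (diffs (x + y) ord0 d)) => ->; case: ifP.
  have : (0 < #|D|)%N.
    rewrite card_gt0; apply: contraNneq neq_d => D0.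
    rewrite -subr_eq0; apply/eqP/rowP => k.
    have : k \notin D by rewrite D0 inE.
    by rewrite inE negbK diffsD !mxE addFF2_eq0 => /eqP ->; rewrite subrr.
  case cD: #|D| cardD => [|[|[|//]]] // _ _.
    have /eqP/cards1P[b Db] := cD.
    (* Here [x + y] changes value once, after [b]. The initial segment serves as interval, since the
       tail would need the end [n.+1], which is not an index. *)
    exists ord0, (lift ord0 b), (1 + s); split=> // k.
    rewrite (e (b < k)%N%:R); last by rewrite sumD Db big_set1.
    rewrite lift0 leq0n [(k < b.+1)%N]ltnS (leqNgt k b) natr_negb.
    by rewrite [1 + s]addrC -[1 + _ + _]addrA -addrA addKF2.
  have /eqP/cards2P[a [b [neq_ab Dab]]] := cD.
  wlog lt_ab : a b neq_ab Dab / (a < b)%N.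
    move=> W; case: (ltngtP a b) => [|lt_ba|/val_inj eab]; first exact: W.
      by apply: (W b a) => //; rewrite 1?eq_sym // setUC.
    by rewrite eab eqxx in neq_ab.
  exists (lift ord0 a), (lift ord0 b), s; split=> [|k].
    by rewrite /= /bump !leq0n !add1n ltnS.
  apply: e; rewrite sumD Dab big_setU1 ?inE // big_set1 !lift0 ltnS.
  case: (ltnP b k) => [lt_bk | _]; last by rewrite andbT; apply: addr0.
  by rewrite (ltn_trans lt_ab lt_bk); apply: addFF2.
case: (F2P c) e => -> e; [exists y | exists (compl y)]; exists i, j; split=> //;
  [by left | | by right |]; apply/half_compl_eq; rewrite ?(ltnW lt_ij) // => k.
  by rewrite e add0r.
by rewrite mxE mxE e addKF2.
Qed.

(* The state shared by the two cycles forces x_i = y_j = x_j, whereas the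
   state obtained by exchanging x and y forces y_i = x_j. *)
Lemma two_cycles_half_compl_neq f x y (i j : 'I_n.+1) :
  sds_map f x = compl x -> sds_map f y = compl y -> (i < j)%N ->
  half_compl x i <> half_compl y j.
Proof.
move=> /sds_map_complP fx /sds_map_complP fy lt_ij exy.
have /half_compl_eq e := exy; have {}e := e (ltnW lt_ij).
have eyx : half_compl y i = half_compl x j.
  apply/half_compl_eq; rewrite ?(ltnW lt_ij) // => k.
  by rewrite e addKF2.
have ej : y ord0 j = x ord0 j by rewrite e ltnn andbF; apply: add0r.
have ei : y ord0 i = 1 + x ord0 i by rewrite e leqnn lt_ij.
have := fx i; rewrite exy fy ej => /addrI xji.
have := fy i; rewrite eyx fx ei xji => /addrI/esym.
exact: add1_neqF2.
Qed.

(** * From a vertex function to a code *)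

Definition compl_points f := [set x | (sds_map f x == compl x) &&
  (sds_map f (compl x) == x)].

Lemma two_cyclesE f : two_cycles (sds_map f) =
  [set [set x; compl x] | x in compl_points f].
Proof.
apply/setP => A; apply/imsetP/imsetP => -[x].
  rewrite inE => /andP[neq_x /eqP F2x] ->.
  have Fx := two_cycle_compl neq_x F2x.
  by exists x; rewrite -?Fx // inE -Fx F2x !eqxx.
rewrite inE => /andP[/eqP Fx /eqP Fcx] ->; exists x; last by rewrite Fx.
by rewrite inE Fx Fcx compl_neq eqxx.
Qed.

(** At distance 1 or 2, a state of [x] would coincide with one of [y] or [compl y] at a later time,
    and [f] complements all these points. *)
Lemma compl_points_min_dist f : min_dist_geq 3 (diffs @: compl_points f).
Proof.
apply/forall_inP => _ /imsetP[x + ->]; rewrite inE => /andP[/eqP Fx _].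
apply/forall_inP => _ /imsetP[y + ->]; rewrite inE => /andP[/eqP Fy /eqP Fcy].
apply/implyP => neq_d; rewrite ltnNge; apply/negP => le2.
have [y' [i [j [Ey' lt_ij]]]] := hamming_dist_diffs_le2 neq_d le2.
apply: (two_cycles_half_compl_neq (f := f)) => //.
by case: Ey' => ->; rewrite ?complK.
Qed.

(** Each 2-cycle is recovered from its difference vector. *)
Lemma card_two_cycles_le f :
  (#|two_cycles (sds_map f)| <= #|diffs @: compl_points f|)%N.
Proof.
pose pair u := [set sums u; compl (sums u)].
suff -> : two_cycles (sds_map f) = pair @: (diffs @: compl_points f).
  exact: leq_imset_card.
rewrite two_cyclesE -imset_comp; apply: eq_imset => x; rewrite /= /pair.
have [{1 2}-> //|{1 2}->] := diffs_inj (sumsK (diffs x)).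
by rewrite complK setUC.
Qed.

(** * From a code to a vertex function *)

(** The condition [f (half_compl x i) = 1 + x ord0 i] demands the value 1 when [x ord0 i] is 0;
    states without such a demand get 0. *)
Definition code_rule (C : {set 'rV['F_2]_n}) : {ffun 'rV['F_2]_n.+1 -> 'F_2} :=
  [ffun z => [exists x, exists i : 'I_n.+1,
    [&& diffs x \in C, z == half_compl x i & x ord0 i == 0]]%:R].

(** By the distance bound, states of code pairs coincide only at equal times, where their demands
    agree. *)
Lemma code_ruleP C x : min_dist_geq 3 C -> diffs x \in C ->
  sds_map (code_rule C) x = compl x.
Proof.
move=> /forall_inP dC Cx; apply/sds_map_complP => i; rewrite ffunE.
have far y (j k : 'I_n.+1) z : diffs y \in C -> diffs z \in C ->
    half_compl y j = half_compl z k -> (j < k)%N = false.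
  move=> Cy Cz e; apply/negP => lt_jk.
  have [neq le2] := hamming_dist_half_compl lt_jk e.
  have /forall_inP/(_ _ Cz)/implyP/(_ neq) := dC _ Cy.
  by rewrite ltnNge le2.
case: existsP => [[y /existsP[j /and3P[Cy /eqP exy /eqP yj0]]] | notE].
  have eij : i = j.
    apply: val_inj; case: (ltngtP i j) => //.
      by rewrite (far _ _ _ _ Cx Cy exy).
    by rewrite (far _ _ _ _ Cy Cx (esym exy)).
  (* Coordinate [i] is still untouched at time [i], so [x] and [y] agree there. *)
  have /rowP/(_ i) := exy; rewrite !half_complE eij ltnn yj0 !add0r => ->.
  by rewrite addr0.
case: (F2P (x ord0 i)) => xi0; last by rewrite xi0 addFF2.
by case: notE; exists x; apply/existsP; exists i; rewrite Cx xi0 !eqxx.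
Qed.

Lemma card_two_cycles_code_rule C : min_dist_geq 3 C ->
  (#|C| <= #|two_cycles (sds_map (code_rule C))|)%N.
Proof.
move=> dC; pose pair u := [set sums u; compl (sums u)].
(* [diffs] takes the value [u] on both points of [pair u]. *)
have pair_inj : injective pair.
  move=> u v /setP/(_ (sums u)); rewrite !inE eqxx /= => /esym/orP[] /eqP E.
    by rewrite -(sumsK u) E sumsK.
  by rewrite -(sumsK u) E diffs_compl sumsK.
rewrite -(card_imset _ pair_inj) two_cyclesE.
apply/subset_leq_card/subsetP => _ /imsetP[u Cu ->].
apply/imsetP; exists (sums u) => //.
have Cs : diffs (sums u) \in C by rewrite sumsK.
rewrite inE code_ruleP // eqxx code_ruleP ?diffs_compl //.
by rewrite complK /=.
Qed.

End Cycles.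

Theorem theorem2 (n : nat) (hn : 0 < n) : eta n.+1 = max_code_size n 3.
Proof.
apply/eqP; rewrite eqn_leq; apply/andP; split.
  apply/bigmax_leqP => f _; apply: leq_trans (card_two_cycles_le f) _.
  exact: bigmax_sup (compl_points_min_dist f) (leqnn _).
apply/bigmax_leqP => C dC; apply: leq_trans (card_two_cycles_code_rule dC) _.
exact: (bigmax_sup (code_rule C)).
Qed.
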